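(* Let $q$ be an odd prime power, let $A\in M_2(\mathbb{F}_{q^2})$, and assume that $F_A$ is nonsingular. Furthermore, assume that there is at least one eigenvalue of $A$ in $\mathbb{F}_{q^2}$ with a corresponding eigenvector $\mathbf{u}$ such that $\langle\mathbf{u},\mathbf{u}\rangle\neq 0$. Let $z\in W(A)$ and let $S_z=\{\mathbf v\mid \langle A \mathbf v, \mathbf v\rangle=z,\ \langle\mathbf{v},\mathbf{v}\rangle=1\}$, i.e. the pre-image of the numerical range map at $z$. Let $\mathcal U=\{k+\beta \ell\in \mathbb{F}_{q^2}\mid k^2-\alpha \ell^2=1\}$, the set of unitary elements in $\mathbb{F}_{q^2}$. If $z \in \Gamma_F^\wedge$, then $|S_z/\mathcal U| = 1$. If $z\notin \Gamma_F^\wedge$ then $|S_z/\mathcal U|=2$. Equivalently, if $z \in \Gamma_F^\wedge$ then $|S_z| = q + 1$, and if $z \notin \Gamma_F^\wedge$ then $|S_z| = 2q + 2$.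
   Context: Setting: $q$ is an odd prime power, $\mathbb{F}_q$ the field with $q$ elements, $\alpha\in\mathbb{F}_q$ a non-square, and $\beta\in\mathbb{F}_{q^2}$ with $\beta^2=\alpha$, so $\mathbb{F}_{q^2}=\mathbb{F}_q[\beta]$. For $x\in\mathbb{F}_{q^2}$ write $\overline{x}=x^q$ and $|x|^2=x\overline{x}$. For a matrix $A$, $A^*$ is the transpose with $x\mapsto x^q$ applied to each entry; the Hermitian form on $\mathbb{F}_{q^2}^n$ is $\langle\mathbf u,\mathbf v\rangle=\mathbf v^*\mathbf u$. The numerical range is $W(A)=\{\langle A\mathbf v,\mathbf v\rangle : \langle\mathbf v,\mathbf v\rangle=1,\ \mathbf v\in\mathbb{F}_{q^2}^n\}$. Let $H_1=\mathrm{Re}\,A=(A+A^* )/2$ and $H_2=\mathrm{Im}\,A=(A-A^* )/(2\beta)$ (both Hermitian, $A=H_1+\beta H_2$). The base polynomial is $F_A(x:y:t)=\det(xH_1+yH_2+tI_n)$, a homogeneous polynomial with coefficients in $\mathbb{F}_q$; its zero set $\Gamma_F$ in $\mathbb{P}^2(\mathbb{F}_{q^2})$ is the base curve, and the dual curve $\Gamma_F^\wedge$ of $\Gamma_F$ is the boundary generating curve. Affine $\mathbb{F}_q$-points $(x,y)$ of $\Gamma_F^\wedge$ are identified with elements $x+\beta y\in\mathbb{F}_{q^2}$. *)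

(* Defs.v *)
From HB Require Import structures.
From mathcomp Require Import all_boot all_order all_algebra.
From mathcomp Require Export mpoly.

Set Implicit Arguments.
Unset Strict Implicit.
Unset Printing Implicit Defensive.

Import GRing.Theory.
Local Open Scope ring_scope.

(* Throughout, F is the field with q elements, K the field with q^2 elements,
   iota : F -> K the inclusion, and beta in K satisfies beta^2 = iota alpha for
   a non-square alpha of F; these requirements are hypotheses of the theorem. *)

(* Hermitian geometry over K, with conjugation x |-> x^q *)

Definition adjmx (K : finFieldType) (q m n : nat) (A : 'M[K]_(m, n)) :
    'M[K]_(n, m) :=
  map_mx (fun x => x ^+ q) A^T.

Definition herm (K : finFieldType) (q n : nat) (u v : 'cV[K]_n) : K :=
  (adjmx q v *m u) 0 0.

Definition numerical_range (K : finFieldType) (q n : nat) (A : 'M[K]_n) :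
    {set K} :=
  [set herm q (A *m v) v | v : 'cV[K]_n & herm q v v == 1].

Definition nr_fiber (K : finFieldType) (q n : nat) (A : 'M[K]_n) (z : K) :
    {set 'cV[K]_n} :=
  [set v : 'cV[K]_n | (herm q (A *m v) v == z) && (herm q v v == 1)].

Definition unitaries (F K : finFieldType) (iota : {rmorphism F -> K})
    (alpha : F) (beta : K) : {set K} :=
  [set iota k + beta * iota l | k in F, l in F & k ^+ 2 - alpha * l ^+ 2 == 1].

(* S / U, for the action of U on column vectors by scaling, as the set of
   U-orbits of the elements of S *)
Definition scaling_orbits (K : finFieldType) (n : nat)
    (S : {set 'cV[K]_n}) (U : {set K}) : {set {set 'cV[K]_n}} :=
  [set [set c *: v | c in U] | v in S].

Definition is_eigenpair (K : finFieldType) (n : nat) (A : 'M[K]_n)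
    (lambda : K) (u : 'cV[K]_n) : Prop :=
  u != 0 /\ A *m u = lambda *: u.

(* The base polynomial, in the variables x = 'X_0, y = 'X_1, t = 'X_2 *)

Definition re_mx (K : finFieldType) (q n : nat) (A : 'M[K]_n) : 'M[K]_n :=
  2^-1 *: (A + adjmx q A).

Definition im_mx (K : finFieldType) (q : nat) (beta : K) (n : nat)
    (A : 'M[K]_n) : 'M[K]_n :=
  (2 * beta)^-1 *: (A - adjmx q A).

Definition base_poly (K : finFieldType) (q : nat) (beta : K) (n : nat)
    (A : 'M[K]_n) : {mpoly K[3]} :=
  \det ('X_0 *: map_mx (@mpolyC 3 K) (re_mx q A)
        + 'X_1 *: map_mx (@mpolyC 3 K) (im_mx q beta A)
        + ('X_2)%:M).

(* Plane projective curves: points of P^2(K) are given by homogeneous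
   coordinates, i.e. by nonzero row vectors of length 3, up to scaling. The
   predicates below are used with homogeneous polynomials only, for which they
   do not depend on the chosen coordinates. *)

Definition hcoord (K : finFieldType) (x y t : K) : 'rV[K]_3 :=
  \row_(i < 3) [:: x; y; t]`_i.

Definition on_curve (K : finFieldType) (p : {mpoly K[3]}) (P : 'rV[K]_3) :
    Prop :=
  P != 0 /\ p.@[P 0] = 0.

Definition gradient (K : finFieldType) (p : {mpoly K[3]}) (P : 'rV[K]_3) :
    'rV[K]_3 :=
  \row_(i < 3) (p^`M(i)).@[P 0].

(* The partial derivatives have no common zero on the curve in P^2(K). For the
   base polynomial of a 2 x 2 matrix they are linear forms, so looking for
   singular points over an extension of K would not change the notion. *)
Definition nonsingular (K : finFieldType) (p : {mpoly K[3]}) : Prop :=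
  forall P : 'rV[K]_3, on_curve p P -> gradient p P != 0.

(* (a : b : c) is on the dual curve iff the line a x + b y + c t = 0 is the
   tangent line of the curve at one of its nonsingular points. *)
Definition on_dual_curve (K : finFieldType) (p : {mpoly K[3]})
    (Q : 'rV[K]_3) : Prop :=
  Q != 0 /\ exists P : 'rV[K]_3, exists c : K,
    [/\ on_curve p P, c != 0 & gradient p P = c *: Q].

(* z = x + beta y is identified with the affine F-point (x : y : 1). *)
Definition in_boundary_curve (F K : finFieldType) (iota : {rmorphism F -> K})
    (q : nat) (beta : K) (n : nat) (A : 'M[K]_n) (z : K) : Prop :=
  exists x y : F, z = iota x + beta * iota y /\
    on_dual_curve (base_poly q beta A) (hcoord (iota x) (iota y) 1).

(* Main.v *)
(* An eigenvector of nonzero norm can be normalised and completed to a unitary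
   basis, so A may be taken upper triangular, with diagonal l, l + m
   and corner b.  For v in S_z put s = |v_2|^2; since z - l - m s = b conj(v_1) v_2,
   the orbits of S_z under the unitaries correspond to the roots s in F of
   |z - l - m s|^2 = |b|^2 s (1 - s).  Nonsingularity of F_A says that b != 0 and
   that the leading coefficient |m|^2 + |b|^2 is nonzero, so there are one or two
   orbits according to the discriminant, whose vanishing is the equation of the
   dual conic. *)
Require Import Defs.
From mathcomp Require Import all_boot all_order all_algebra all_fingroup.
From mathcomp Require Import all_solvable all_field ring.

Set Implicit Arguments.
Unset Strict Implicit.
Unset Printing Implicit Defensive.

Import GRing.Theory.
Local Open Scope ring_scope.

(** * Conjugation and norm *)

(** The additive group is elementary abelian, so [q] is a power of the characteristic; this makes
    the conjugation [x ^+ q] additive. *)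
Lemma card_finField_pnat (F : finFieldType) : [pchar F].-nat #|F|.
Proof.
have [p _ pF] := finPcharP F.
rewrite (eq_pnat _ (pcharf_eq pF)) -cardsT.
exact: abelem_pgroup (fin_ring_pchar_abelem pF).
Qed.

Section Conjugation.

Variables (q : nat) (F K : finFieldType) (iota : {rmorphism F -> K}).
Hypotheses (hq : odd q) (hF : #|F| = q) (hK : #|K| = (q ^ 2)%N).

Lemma q_gt1 : (1 < q)%N.
Proof. by rewrite -hF; apply: finNzRing_gt1. Qed.

Lemma conjD (x y : K) : (x + y) ^+ q = x ^+ q + y ^+ q.
Proof.
apply: exprDn_pchar; rewrite (eq_pnat _ (fmorph_pchar iota)) -hF.
exact: card_finField_pnat.
Qed.

Lemma conjN (x : K) : (- x) ^+ q = - x ^+ q.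
Proof. by rewrite exprNn -signr_odd hq expr1 mulN1r. Qed.

Lemma conjB (x y : K) : (x - y) ^+ q = x ^+ q - y ^+ q.
Proof. by rewrite conjD conjN. Qed.

Lemma conj_nat n : (n%:R : K) ^+ q = n%:R.
Proof.
elim: n => [|n IHn]; first by rewrite expr0n gtn_eqF // ltnW // q_gt1.
by rewrite -addn1 natrD conjD IHn expr1n.
Qed.

Lemma conjK (x : K) : (x ^+ q) ^+ q = x.
Proof. by rewrite -exprM mulnn -hK expf_card. Qed.

Lemma conj_iota (y : F) : iota y ^+ q = iota y.
Proof. by rewrite -rmorphXn -hF /= expf_card. Qed.

(** [X^q - X] has at most [q] roots, and the image of [iota] already supplies [q] of them. *)
Lemma conj_fixedP (x : K) : x ^+ q = x -> exists y, x = iota y.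
Proof.
move=> xq; pose s := map iota (enum F).
have s_uniq : uniq s by rewrite map_inj_uniq ?enum_uniq //; apply: fmorph_inj.
case xs: (x \in s); first by case/mapP: xs => y _ ->; exists y.
have sz_p : size ('X^q - 'X : {poly K}) = q.+1.
  by rewrite size_polyDl size_polyXn // size_polyN size_polyX ltnS q_gt1.
have p_neq0 : 'X^q - 'X != 0 :> {poly K} by rewrite -size_poly_gt0 sz_p.
suff /(max_poly_roots p_neq0) : all (root ('X^q - 'X)) (x :: s).
  by rewrite /= xs s_uniq sz_p size_map -cardE hF ltnn => /(_ isT).
rewrite /= rootE !hornerE xq subrr eqxx /=; apply/allP => _ /mapP[y _ ->].
by rewrite rootE !hornerE conj_iota subrr.
Qed.

(** In characteristic 2 the odd number [q] would be a power of 2, hence 1. *)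
Lemma two_neq0 : (2 : K) != 0.
Proof.
apply/negP => two0; have pK : 2%N \in [pchar K] by rewrite inE.
have pF : 2%N \in [pchar F] by rewrite -(fmorph_pchar iota).
have := card_finField_pnat F; rewrite (eq_pnat _ (pcharf_eq pF)) hF.
case/p_natP => n qE; have := hq; rewrite qE oddX orbF => /eqP n0.
by have := q_gt1; rewrite qE n0.
Qed.

Lemma norm_eq0 (x : K) : (x * x ^+ q == 0) = (x == 0).
Proof. by rewrite -exprS expf_eq0. Qed.

Lemma conj_norm (x : K) : (x * x ^+ q) ^+ q = x * x ^+ q.
Proof. by rewrite exprMn conjK mulrC. Qed.

(* Each fibre of the norm on the nonzero elements is the zero set of X^(q+1) - c,
   and the q - 1 fibres add up to q^2 - 1 elements. *)
Lemma card_norm_fiber (c : F) :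
  c != 0 -> #|[set x : K | x * x ^+ q == iota c]| = q.+1.
Proof.
pose N c := [set x : K | x * x ^+ q == iota c].
have leN d : (#|N d| <= q.+1)%N.
  have sz_p : size ('X^(q.+1) - (iota d)%:P : {poly K}) = q.+2.
    by rewrite size_XnsubC.
  have p_neq0 : 'X^(q.+1) - (iota d)%:P != 0 :> {poly K}.
    by rewrite -size_poly_gt0 sz_p.
  rewrite -ltnS -sz_p cardE; apply: max_poly_roots p_neq0 _ (enum_uniq _).
  apply/allP => x; rewrite mem_enum inE => /eqP xE.
  by rewrite rootE !hornerE exprS xE subrr.
have sumN : (\sum_(d : F | d != 0%R) #|N d| = \sum_(d : F | d != 0%R) q.+1)%N.
  rewrite sum_nat_const (cardC1 0) hF.
  have -> : (q.-1 * q.+1 = #|K|.-1)%N.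
    by rewrite hK -!subn1 -[in RHS](exp1n 2) subn_sqr addn1.
  (* The default 0 is never returned: norms are fixed by conjugation, hence lie in the image of
     [iota]. *)
  pose M (x : K) : F := odflt 0 [pick y | x * x ^+ q == iota y].
  have ME x : x * x ^+ q = iota (M x).
    rewrite /M; case: pickP => [y /eqP //|] noy.
    by case: (conj_fixedP (conj_norm x)) => y yE; have := noy y; rewrite yE eqxx.
  rewrite -(cardC1 (0 : K)) -sum1_card (partition_big M (fun d => d != 0)) => /=.
    apply: eq_bigr => d d0; rewrite -sum1_card; apply: eq_bigl => x.
    rewrite !inE ME fmorph_eq andb_idl // => /eqP Md.
    by rewrite -norm_eq0 ME Md fmorph_eq0.
  by move=> x; rewrite !inE -norm_eq0 ME fmorph_eq0.
(* Termwise bounds with equal sums are equalities in each term. *)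
move=> c0; have [_] := leqif_sum (fun d (_ : d != 0) => leqif_geq (leN d)).
by rewrite sumN eqxx => /esym /forall_inP /(_ c c0) h; apply/eqP; rewrite eqn_leq leN.
Qed.

Lemma norm_surj (c : K) : c ^+ q = c -> c != 0 -> exists x, x * x ^+ q = c.
Proof.
move=> /conj_fixedP[d ->]; rewrite fmorph_eq0 => /card_norm_fiber cN.
have /card_gt0P[x] : (0 < #|[set x : K | (x * x ^+ q == iota d)%R]|)%N by rewrite cN.
by rewrite inE => /eqP xE; exists x.
Qed.

Lemma card_norm1 : #|[set x : K | x * x ^+ q == 1]| = q.+1.
Proof. by rewrite -(rmorph1 iota) card_norm_fiber // oner_neq0. Qed.

(** * Coordinates with respect to [beta] and the unitary elements *)

Variables (alpha : F) (beta : K).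
Hypotheses (halpha : forall x : F, x ^+ 2 != alpha) (hbeta : beta ^+ 2 = iota alpha).

Lemma beta_neq0 : beta != 0.
Proof.
apply/eqP => b0; have /eqP[] := halpha 0; apply: (fmorph_inj iota).
by rewrite -hbeta b0 rmorphXn rmorph0.
Qed.

(** [beta ^+ q] is also a square root of [alpha]; were it [beta] itself, [beta] would lie in [F] and
    [alpha] would be a square. *)
Lemma conj_beta : beta ^+ q = - beta.
Proof.
have /eqP : (beta ^+ q) ^+ 2 = beta ^+ 2 by rewrite exprAC hbeta conj_iota.
rewrite eqf_sqr => /orP[|] /eqP // /conj_fixedP[y yE].
have /eqP[] := halpha y; apply: (fmorph_inj iota).
by rewrite -hbeta yE rmorphXn.
Qed.

(** The coordinates [(x + x ^+ q) / 2] and [(x - x ^+ q) / (2 * beta)] are fixed by conjugation, so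
    they lie in [F]. *)
Lemma conj_decomposition (x : K) : exists k l, x = iota k + beta * iota l.
Proof.
have [k kE] : exists k, (x + x ^+ q) / 2 = iota k.
  by apply: conj_fixedP; rewrite exprMn exprVn conj_nat conjD conjK addrC.
have [l lE] : exists l, (x - x ^+ q) / (2 * beta) = iota l.
  apply: conj_fixedP; rewrite exprMn exprVn exprMn conj_nat conjB conjK conj_beta.
  by rewrite mulrN invrN mulrN -mulNr opprB.
by exists k, l; rewrite -kE -lE; field; rewrite two_neq0 beta_neq0.
Qed.

Lemma conj_coord (k l : F) :
  (iota k + beta * iota l) ^+ q = iota k - beta * iota l.
Proof. by rewrite conjD exprMn conj_beta !conj_iota mulNr. Qed.

(** [k ^+ 2 - alpha * l ^+ 2] is the norm of [iota k + beta * iota l]. *)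
Lemma unitariesE : unitaries iota alpha beta = [set x | x * x ^+ q == 1].
Proof.
have nE k l : (iota k + beta * iota l) * (iota k + beta * iota l) ^+ q
      = iota (k ^+ 2 - alpha * l ^+ 2).
  rewrite conj_coord rmorphB [iota (alpha * _)]rmorphM /= -hbeta !rmorphXn; ring.
apply/setP => x; rewrite inE; apply/imset2P/idP.
  by case=> k l _; rewrite inE => /andP[_ /eqP kl] ->; rewrite nE kl rmorph1.
have [k [l ->]] := conj_decomposition x.
move=> xN; exists k l => //; rewrite inE /=; apply/eqP/(fmorph_inj iota).
by rewrite rmorph1 -nE; apply/eqP.
Qed.

End Conjugation.

(** * Unitary similarity *)

Lemma ord2_eq (i : 'I_2) : (i == 0) || (i == 1).
Proof. by case: i => [[|[|]]]. Qed.

Lemma det_mx22 (R : comNzRingType) (M : 'M[R]_2) :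
  \det M = M 0 0 * M 1 1 - M 0 1 * M 1 0.
Proof.
have lift1 : lift ord0 ord0 = 1 :> 'I_2 by exact: val_inj.
have lift0 : lift 1 0 = 0 :> 'I_2 by exact: val_inj.
rewrite (expand_det_row _ 0) !big_ord_recl big_ord0 addr0 /cofactor !det_mx11 !mxE.
by rewrite /= mul1r mulN1r mulrN lift1 lift0.
Qed.

Lemma sum_ord2 (V : nmodType) (f : 'I_2 -> V) : \sum_i f i = f 0 + f 1.
Proof.
rewrite !big_ord_recl big_ord0 addr0; congr (f _ + f _); exact: val_inj.
Qed.

Lemma mulmx_linv_inj (R : pzRingType) (n p : nat) (V W : 'M[R]_n) :
  W *m V = 1%:M -> injective (mulmx V : 'M_(n, p) -> 'M_(n, p)).
Proof.
by move=> WV; apply: (can_inj (g := mulmx W)) => v; rewrite mulmxA WV mul1mx.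
Qed.

(** Left multiplication by [V] is injective and commutes with scaling, so it carries orbits
    bijectively to orbits. *)
Lemma scaling_orbits_mulmx (K : finFieldType) (n : nat) (V W : 'M[K]_n)
    (S : {set 'cV[K]_n}) (U : {set K}) :
  W *m V = 1%:M ->
  #|scaling_orbits [set V *m v | v in S] U| = #|scaling_orbits S U|.
Proof.
move=> WV; have V_inj := mulmx_linv_inj WV (p := 1).
rewrite -[RHS](card_imset _ (imset_inj V_inj)) /scaling_orbits -!imset_comp.
congr #|pred_of_set _|; apply: eq_imset => v /=.
by rewrite -imset_comp; apply: eq_imset => c /=; rewrite scalemxAr.
Qed.

(** The scalar term equals its own conjugate [W *m t%:M *m V], so the whole pencil is conjugated.
    The ring is general because the lemma is applied to polynomial matrices. *)
Lemma det_pencil_conj (R : comNzRingType) (n : nat) (V W P Q : 'M[R]_n)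
    (x y t : R) :
  W *m V = 1%:M ->
  \det (x *: (W *m P *m V) + y *: (W *m Q *m V) + t%:M)
  = \det (x *: P + y *: Q + t%:M).
Proof.
move=> WV; have tE : t%:M = W *m t%:M *m V.
  by rewrite mul_mx_scalar -scalemxAl WV scale_scalar_mx mulr1.
rewrite [in LHS]tE (scalemxAl x _ V) (scalemxAl y _ V) (scalemxAr x W) (scalemxAr y W).
rewrite -!mulmxDl -!mulmxDr !det_mulmx mulrAC -det_mulmx WV.
by rewrite det1 mul1r.
Qed.

Section UnitarySimilarity.

Variables (q : nat) (F K : finFieldType) (iota : {rmorphism F -> K}).
Hypotheses (hq : odd q) (hF : #|F| = q) (hK : #|K| = (q ^ 2)%N).

Lemma conj_sum (I : Type) (r : seq I) (f : I -> K) :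
  (\sum_(i <- r) f i) ^+ q = \sum_(i <- r) f i ^+ q.
Proof.
apply: (big_morph (fun x => x ^+ q)) => [x y|]; first exact: (conjD iota hF).
by rewrite expr0n gtn_eqF // ltnW // (q_gt1 hF).
Qed.

Lemma adjmxM (m n p : nat) (A : 'M[K]_(m, n)) (B : 'M[K]_(n, p)) :
  adjmx q (A *m B) = adjmx q B *m adjmx q A.
Proof.
apply/matrixP => i j; rewrite !mxE conj_sum; apply: eq_bigr => k _.
by rewrite !mxE exprMn mulrC.
Qed.

Lemma adjmxK (m n : nat) (A : 'M[K]_(m, n)) : adjmx q (adjmx q A) = A.
Proof. by apply/matrixP => i j; rewrite !mxE (conjK hK). Qed.

Variable n : nat.
Variables (V : 'M[K]_n) (A : 'M[K]_n).
Hypothesis VV : adjmx q V *m V = 1%:M.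
Local Notation B := (adjmx q V *m A *m V).

Lemma nr_fiber_unitary (z : K) :
  nr_fiber q A z = [set V *m v | v in nr_fiber q B z].
Proof.
have inB v : (v \in nr_fiber q B z) = (V *m v \in nr_fiber q A z).
  by rewrite !inE /herm !adjmxM !mulmxA -(mulmxA _ (adjmx q V) V) VV mulmx1.
apply/setP => v; apply/idP/imsetP => [vA|[w wB ->]]; last by rewrite -inB.
exists (adjmx q V *m v); last by rewrite mulmxA (mulmx1C VV) mul1mx.
by rewrite inB mulmxA (mulmx1C VV) mul1mx.
Qed.

(** Taking adjoints commutes with unitary conjugation, so the real and imaginary parts are
    conjugated by the same [V]. *)
Lemma base_poly_unitary (beta : K) : base_poly q beta B = base_poly q beta A.
Proof.
have adjB : adjmx q B = adjmx q V *m adjmx q A *m V.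
  by rewrite !adjmxM adjmxK mulmxA.
have re_mxB : re_mx q B = adjmx q V *m re_mx q A *m V.
  by rewrite /re_mx adjB -mulmxDl -mulmxDr -scalemxAr -scalemxAl.
have im_mxB : im_mx q beta B = adjmx q V *m im_mx q beta A *m V.
  by rewrite /im_mx adjB -mulmxBl -mulmxBr -scalemxAr -scalemxAl.
rewrite /base_poly re_mxB im_mxB !map_mxM /=; apply: det_pencil_conj.
by rewrite -map_mxM VV map_mx1.
Qed.

End UnitarySimilarity.

(** * Triangularization by a unitary matrix *)

Section UpperTriangular.

Variables (q : nat) (F K : finFieldType) (iota : {rmorphism F -> K}).
Hypotheses (hq : odd q) (hF : #|F| = q) (hK : #|K| = (q ^ 2)%N).

Lemma herm2E (u v : 'cV[K]_2) :
  herm q u v = v 0 0 ^+ q * u 0 0 + v 1 0 ^+ q * u 1 0.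
Proof. by rewrite /herm mxE sum_ord2 !mxE. Qed.

(** The norm takes every nonzero value in [F], so some [a] has norm [1 / <u, u>] and [a *: u] is a
    unit eigenvector. *)
Lemma unitary_triangularization (A : 'M[K]_2) (lambda : K) (u : 'cV[K]_2) :
  is_eigenpair A lambda u -> herm q u u != 0 ->
  exists2 V : 'M[K]_2, adjmx q V *m V = 1%:M & (adjmx q V *m A *m V) 1 0 = 0.
Proof.
move=> [_ Au] uu_neq0.
have uu_fix : herm q u u ^+ q = herm q u u.
  by rewrite herm2E (conjD iota hF) !exprMn !(conjK hK) mulrC [X in _ + X]mulrC.
have [a aE] : exists a, a * a ^+ q = (herm q u u)^-1.
  by apply: (norm_surj iota hF hK); rewrite ?exprVn ?uu_fix ?invr_eq0.
have [w Aw ww] : exists2 w : 'cV[K]_2, A *m w = lambda *: w &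
    w 0 0 ^+ q * w 0 0 + w 1 0 ^+ q * w 1 0 = 1.
  exists (a *: u); first by rewrite -scalemxAr Au scalerA mulrC -scalerA.
  rewrite !mxE !exprMn -(mulVf uu_neq0) -aE herm2E; ring.
(* The second column [(- conj w_2, conj w_1)] is a unit vector orthogonal to [w]. *)
pose V : 'M[K]_2 := \matrix_(i, j)
  (if j == 0 then w i 0 else if i == 0 then - w 1 0 ^+ q else w 0 0 ^+ q).
have VV : adjmx q V *m V = 1%:M.
  apply/matrixP => i j; rewrite !mxE sum_ord2 !mxE /=.
  have conjNK (x : K) : (- x ^+ q) ^+ q = - x by rewrite (conjN hq) (conjK hK).
  case/orP: (ord2_eq i) => /eqP ->; case/orP: (ord2_eq j) => /eqP -> /=.
  - exact: ww.
  - by rewrite mulrN mulrC addNr.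
  - by rewrite conjNK (conjK hK) mulNr mulrC addNr.
  - by rewrite conjNK (conjK hK) mulrNN -ww addrC; congr (_ + _); rewrite mulrC.
exists V => //; rewrite -mulmxA mxE sum_ord2.
have AV k : (A *m V) k 0 = lambda * V k 0.
  transitivity ((A *m w) k 0); last by rewrite Aw !mxE.
  by rewrite !mxE; apply: eq_bigr => i _; rewrite !mxE.
(* The first column of the product is [lambda] times that of [adjmx q V *m V], the identity. *)
have /matrixP/(_ 1 0) := VV; rewrite mxE sum_ord2 [RHS]mxE /= => VV10.
by rewrite !AV mulrCA [X in _ + X]mulrCA -mulrDr VV10 mulr0.
Qed.

End UpperTriangular.

(** * Fibres of the numerical range map *)

(** Being constant on orbits and separating them, [f] puts orbits in bijection with its values. A
    nonzero vector has trivial stabilizer, so each orbit has [k] elements. *)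
Lemma card_scaling_orbits (K X : finFieldType) (n k : nat)
    (S : {set 'cV[K]_n}) (U : {set K}) (f : 'cV[K]_n -> X) :
  0 \notin S -> #|U| = k ->
  {in S & U, forall v c, c *: v \in S /\ f (c *: v) = f v} ->
  {in S &, forall v w, f v = f w -> exists2 c, c \in U & w = c *: v} ->
  #|scaling_orbits S U| = #|[set f v | v in S]| /\
  #|S| = (#|[set f v | v in S]| * k)%N.
Proof.
move=> S0 Uk S_stable S_orbit; pose g r := [set v in S | f v == r].
have orbE v : v \in S -> [set c *: v | c in U] = g (f v).
  move=> vS; apply/setP => w; rewrite inE; apply/imsetP/andP.
    by case=> c cU ->; have [-> ->] := S_stable v c vS cU; rewrite eqxx.
  by case=> wS /eqP/esym /(S_orbit _ _ vS wS).
have card_g r : r \in [set f v | v in S] -> #|g r| = k.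
  case/imsetP=> v vS ->; rewrite -orbE // card_imset // => c d /eqP.
  rewrite -subr_eq0 -scalerBl scaler_eq0 subr_eq0 => /orP[/eqP //|/eqP v0].
  by rewrite v0 (negPf S0) in vS.
split; last first.
  rewrite -sum1_card (partition_big_imset f) /= -sum_nat_const.
  apply: eq_bigr => r /card_g <-; rewrite -sum1_card.
  by apply: eq_bigl => v; rewrite inE.
have -> : scaling_orbits S U = [set g r | r in [set f v | v in S]].
  by rewrite -imset_comp; apply: eq_in_imset => v /orbE.
apply: card_in_imset => r r' /imsetP[v vS ->] _ gE.
have : v \in g (f v) by rewrite inE vS eqxx.
by rewrite gE inE vS => /eqP.
Qed.

(** The quantity [s = |v_2|^2] that will classify the orbits in a fibre. *)
Definition last_norm (K : finFieldType) (q : nat) (v : 'cV[K]_2) : K :=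
  v 1 0 * v 1 0 ^+ q.

Section TriangularFiber.

Variables (q : nat) (F K : finFieldType) (iota : {rmorphism F -> K}).
Hypotheses (hq : odd q) (hF : #|F| = q) (hK : #|K| = (q ^ 2)%N).
Variables (A : 'M[K]_2) (z : K).
Hypothesis A10 : A 1 0 = 0.

Local Notation l := (A 0 0).
Local Notation b := (A 0 1).
Local Notation m := (A 1 1 - A 0 0).
Local Notation B := (b * b ^+ q).
Local Notation D := (m * m ^+ q + B).
Local Notation Z := (z - l).
Local Notation T := (m ^+ q * Z + m * Z ^+ q + B).

Local Notation w2 := (last_norm q).
Local Notation S := (nr_fiber q A z).
(** Expanding [|Z - m s|^2 = B s (1 - s)] gives this quadratic; being fixed by conjugation selects
    its roots in [F]. *)
Local Notation R := ([set s : K |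
  (s ^+ q == s) && (D * s ^+ 2 - T * s + Z * Z ^+ q == 0)]).

(** Since [A] is upper triangular, [<A v, v> = l <v, v> + b conj(v_1) v_2 + m |v_2|^2]. *)
Lemma fiberP (v : 'cV[K]_2) :
  reflect (v 0 0 * v 0 0 ^+ q = 1 - w2 v /\ b * (v 0 0 ^+ q * v 1 0) = Z - m * w2 v)
          (v \in S).
Proof.
have zE : herm q (A *m v) v = l * herm q v v + (b * (v 0 0 ^+ q * v 1 0) + m * w2 v).
  rewrite !herm2E !mxE !sum_ord2 A10 /last_norm; ring.
have nE : herm q v v = v 0 0 * v 0 0 ^+ q + w2 v.
  by rewrite herm2E /last_norm mulrC [X in _ + X]mulrC.
rewrite inE zE; apply: (iffP andP) => [[/eqP h /eqP n1]|[n1 h]].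
  by split; [rewrite -n1 nE addrK | rewrite -h n1; ring].
by rewrite nE n1 h subrK mulr1 subrK addrC subrK !eqxx.
Qed.

Lemma w2_fiber (v : 'cV[K]_2) : v \in S -> w2 v \in R.
Proof.
have sq : w2 v ^+ q = w2 v by rewrite (conj_norm hK).
case/fiberP => n1 h; rewrite inE sq eqxx /=.
have : (Z - m * w2 v) * (Z - m * w2 v) ^+ q = B * ((1 - w2 v) * w2 v).
  by rewrite -h -n1 !exprMn (conjK hK) /last_norm; ring.
rewrite (conjB iota hq hF Z) exprMn sq => e; apply/eqP.
transitivity ((Z - m * w2 v) * (Z ^+ q - m ^+ q * w2 v) - B * ((1 - w2 v) * w2 v)).
  ring.
by rewrite e subrr.
Qed.

Hypothesis b_neq0 : b != 0.

(** The quadratic says that [w = (Z - m s) / b], the required value of [conj(v_1) v_2], has norm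
    [s (1 - s)]. For nonzero [s], taking [v_2] of norm [s] and [v_1 = conj(w / v_2)] gives
    [|v_1|^2 = 1 - s]. *)
Lemma fiber_w2 (s : K) : s \in R -> exists2 v, v \in S & w2 v = s.
Proof.
rewrite inE => /andP[/eqP sq /eqP s_root].
have b'_neq0 : b ^+ q != 0 by rewrite expf_eq0 negb_and b_neq0 orbT.
have vE (x y : K) : exists v : 'cV[K]_2, v 0 0 = x /\ v 1 0 = y.
  by exists (\col_i if i == 0 then x else y); rewrite !mxE.
pose w := (Z - m * s) / b.
have bw : b * w = Z - m * s by rewrite mulrC divfK.
have wN : w * w ^+ q = (1 - s) * s.
  apply: (mulfI b_neq0); apply: (mulfI b'_neq0).
  transitivity ((Z - m * s) * (Z ^+ q - m ^+ q * s)).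
    rewrite /w exprMn exprVn (conjB iota hq hF Z) exprMn sq.
    by field; rewrite b_neq0 b'_neq0.
  apply/eqP; rewrite -subr_eq0; apply/eqP; rewrite -[RHS]s_root ; ring.
(* For [s = 0] division by [v_2] is impossible; then [w = 0] and the first basis vector works. *)
have [s0|s_neq0] := eqVneq s 0.
  have [v [v0 v1]] := vE 1 0; have wv : w2 v = 0 by rewrite /last_norm v1 mul0r.
  exists v; last by rewrite wv.
  apply/fiberP; rewrite wv v0 v1 !mulr0 expr1n mulr1 subr0; split=> //.
  have /eqP : w * w ^+ q = 0 by rewrite wN s0 mulr0.
  by rewrite norm_eq0 -(mulrI_eq0 _ (mulfI b_neq0)) bw s0 mulr0 => /eqP ->.
have [y yN] := norm_surj iota hF hK sq s_neq0.
have y_neq0 : y != 0 by rewrite -(norm_eq0 q) yN.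
have y'_neq0 : y ^+ q != 0 by rewrite expf_eq0 negb_and y_neq0 orbT.
have [v [v0 v1]] := vE ((w / y) ^+ q) y; have wv : w2 v = s by rewrite /last_norm v1.
exists v => //; apply/fiberP; rewrite wv v0 v1 (conjK hK); split; last first.
  by rewrite divfK.
apply: (mulIf s_neq0); rewrite -wN -yN exprMn exprVn.
by field; rewrite y_neq0 y'_neq0.
Qed.

(** As [b] is nonzero, the products [conj(v_1) v_2] agree for both vectors. If the second
    coordinates are nonzero, their ratio has norm 1, and the common product forces the same ratio on
    the first ones. *)
Lemma fiber_w2_inj (v w : 'cV[K]_2) : v \in S -> w \in S -> w2 v = w2 w ->
  exists2 c, c \in [set c : K | c * c ^+ q == 1] & w = c *: v.
Proof.
move=> /fiberP[nv hv] /fiberP[nw hw] vw.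
have prodE : v 0 0 ^+ q * v 1 0 = w 0 0 ^+ q * w 1 0.
  by apply: (mulfI b_neq0); rewrite hv hw vw.
have vecP (c : K) : w 0 0 = c * v 0 0 -> w 1 0 = c * v 1 0 -> w = c *: v.
  move=> w0 w1; apply/colP => i; rewrite mxE.
  by case/orP: (ord2_eq i) => /eqP ->.
(* When the second coordinates vanish, the first ones have norm 1 and their ratio serves as [c]. *)
have [v1|v1_neq0] := eqVneq (v 1 0) 0.
  have w1 : w 1 0 = 0.
    by apply/eqP; rewrite -(norm_eq0 q) -/(w2 w) -vw /last_norm v1 mul0r.
  have v0N : v 0 0 * v 0 0 ^+ q = 1 by rewrite nv /last_norm v1 mul0r subr0.
  have w0N : w 0 0 * w 0 0 ^+ q = 1 by rewrite nw /last_norm w1 mul0r subr0.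
  have v0_neq0 : v 0 0 != 0 by rewrite -(norm_eq0 q) v0N oner_neq0.
  exists (w 0 0 / v 0 0); last by apply: vecP; rewrite ?divfK // v1 mulr0.
  by rewrite inE exprMn exprVn mulrACA -invfM v0N w0N divr1.
have w1_neq0 : w 1 0 != 0 by rewrite -(norm_eq0 q) -/(w2 w) -vw norm_eq0.
have cN : (w 1 0 / v 1 0) * (w 1 0 / v 1 0) ^+ q = 1.
  by rewrite exprMn exprVn mulrACA -invfM -/(w2 w) -/(w2 v) -vw divff // norm_eq0.
exists (w 1 0 / v 1 0); first by rewrite inE cN.
apply: vecP; last by rewrite divfK.
set c := w 1 0 / v 1 0 in cN *.
have cw : w 1 0 = c * v 1 0 by rewrite /c divfK.
have : v 0 0 ^+ q = w 0 0 ^+ q * c.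
  by apply: (mulIf v1_neq0); rewrite prodE cw mulrA.
move/(congr1 (fun x => x ^+ q)); rewrite exprMn !(conjK hK) => ->.
by rewrite mulrCA cN mulr1.
Qed.

Lemma fiber_stable (v : 'cV[K]_2) (c : K) :
  v \in S -> c \in [set c : K | c * c ^+ q == 1] ->
  c *: v \in S /\ w2 (c *: v) = w2 v.
Proof.
move=> /fiberP[n1 h]; rewrite inE => /eqP cN.
have w2E : w2 (c *: v) = w2 v by rewrite /last_norm mxE exprMn mulrACA cN mul1r.
split=> //; apply/fiberP; rewrite w2E !mxE exprMn mulrACA cN mul1r; split=> //.
by rewrite mulrACA [_ * c]mulrC cN mul1r.
Qed.

Lemma card_triangular_fiber :
  #|scaling_orbits S [set c : K | c * c ^+ q == 1]| = #|R| /\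
  #|S| = (#|R| * q.+1)%N.
Proof.
have <- : [set w2 v | v in S] = R.
  apply/setP => s; apply/imsetP/idP => [[v vS ->]|/fiber_w2[v vS <-]].
    exact: w2_fiber.
  by exists v.
apply: card_scaling_orbits (card_norm1 iota hF hK) _ _.
- by rewrite inE negb_and orbC herm2E !mxE !mulr0 addr0 eq_sym oner_neq0.
- by move=> v c; apply: fiber_stable.
- by move=> v w; apply: fiber_w2_inj.
Qed.

Hypothesis D_neq0 : D != 0.

(** One root [s] in [F] forces the other, [T / D - s], into [F], because [T] and [D] are fixed by
    conjugation. The discriminant is the square of [D * (s - s')], so it vanishes exactly when the
    two coincide. *)
Lemma card_fiber_roots : S != set0 ->
  #|R| = (T ^+ 2 - 4 * D * (Z * Z ^+ q) != 0).+1.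
Proof.
case/set0Pn => v /w2_fiber; move: (w2 v) => s sR.
pose s' := T / D - s.
have fixed_DT (x y c : K) :
    (x * x ^+ q + c * c ^+ q) ^+ q = x * x ^+ q + c * c ^+ q /\
    (x ^+ q * y + x * y ^+ q + c * c ^+ q) ^+ q =
      x ^+ q * y + x * y ^+ q + c * c ^+ q.
  by rewrite !(conjD iota hF) !exprMn !(conjK hK); split; ring.
have [Dq Tq] := fixed_DT m Z b.
have [sq s_root] : s ^+ q = s /\ D * s ^+ 2 - T * s + Z * Z ^+ q = 0.
  by move: sR; rewrite inE => /andP[/eqP-> /eqP].
have ZE : Z * Z ^+ q = T * s - D * s ^+ 2.
  by apply/eqP; rewrite -subr_eq0 -[X in _ == X]s_root; apply/eqP; ring.
have -> : R = [set s; s'].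
  apply/setP => x; rewrite !inE.
  have -> : D * x ^+ 2 - T * x + Z * Z ^+ q = D * ((x - s) * (x - s')).
    rewrite ZE /s'; field; exact: D_neq0.
  rewrite mulf_eq0 (negPf D_neq0) /= mulf_eq0 !subr_eq0 andb_idl //.
  case/orP => /eqP ->; first by rewrite sq.
  by rewrite /s' (conjB iota hq hF (T / D)) exprMn exprVn Dq Tq sq.
have -> : T ^+ 2 - 4 * D * (Z * Z ^+ q) = (D * (s - s')) ^+ 2.
  rewrite ZE /s'; field; exact: D_neq0.
by rewrite cards2 expf_eq0 mulf_eq0 (negPf D_neq0) subr_eq0.
Qed.

End TriangularFiber.

(** * Base curve and its dual *)

Lemma mderivXU (R : nzRingType) (n : nat) (i j : 'I_n) :
  ('X_i : {mpoly R[n]})^`M(j) = (i == j)%:R.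
Proof.
rewrite mderivX mnm1E; case: eqP => [->|_]; last by rewrite scale0r.
by rewrite scale1r -mpolyX0; congr 'X_[_]; apply/mnmP => k; rewrite mnmBE subnn mnm0E.
Qed.

Section TriangularBaseCurve.

Variables (q : nat) (F K : finFieldType) (iota : {rmorphism F -> K}).
Hypotheses (hq : odd q) (hF : #|F| = q) (hK : #|K| = (q ^ 2)%N).
Variables (alpha : F) (beta : K).
Hypotheses (halpha : forall x : F, x ^+ 2 != alpha) (hbeta : beta ^+ 2 = iota alpha).

Variable (A : 'M[K]_2).
Hypothesis A10 : A 1 0 = 0.

Local Notation l := (A 0 0).
Local Notation d := (A 1 1).
Local Notation b := (A 0 1).
Local Notation m := (A 1 1 - A 0 0).
Local Notation B := (b * b ^+ q).
Local Notation D := (m * m ^+ q + B).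
Local Notation p := (base_poly q beta A).
(* x Re A + y Im A = xi A + eta A^*, so that L1 and L2 are the diagonal entries
   of the pencil and xi b, eta b^q the other two. *)
Local Notation xi P := (P 0 0 / 2 + P 0 1 / (2 * beta)).
Local Notation eta P := (P 0 0 / 2 - P 0 1 / (2 * beta)).
Local Notation L1 P := (xi P * l + eta P * l ^+ q + P 0 2).
Local Notation L2 P := (xi P * d + eta P * d ^+ q + P 0 2).

Let two_neq0 := two_neq0 iota hq hF.
Let beta_neq0 := beta_neq0 halpha hbeta.

Lemma base_polyE :
  p = ('X_0 * ((l + l ^+ q) / 2)%:MP + 'X_1 * ((l - l ^+ q) / (2 * beta))%:MP + 'X_2)
    * ('X_0 * ((d + d ^+ q) / 2)%:MP + 'X_1 * ((d - d ^+ q) / (2 * beta))%:MP + 'X_2)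
    - ('X_0 * (b / 2)%:MP + 'X_1 * (b / (2 * beta))%:MP)
    * ('X_0 * (b ^+ q / 2)%:MP - 'X_1 * (b ^+ q / (2 * beta))%:MP).
Proof.
have zq : (0 : K) ^+ q = 0 by rewrite expr0n gtn_eqF // ltnW // (q_gt1 hF).
rewrite /base_poly det_mx22 /re_mx /im_mx !mxE /= A10 zq.
rewrite !mulr1n !mulr0n !addr0 !add0r subr0.
by rewrite !(mulrC 2^-1) !(mulrC (2 * beta)^-1) mulNr mpolyCN mulrN.
Qed.

Lemma base_poly_eval (P : 'rV[K]_3) : p.@[P 0] = L1 P * L2 P - xi P * eta P * B.
Proof.
rewrite base_polyE !(mevalB, mevalM, mevalD, mevalC, mevalXU).
by field; rewrite two_neq0 beta_neq0.
Qed.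

(** In the coordinates [xi], [eta], [t] the base polynomial is [L1 L2 - xi eta B], and the left-hand
    sides are its partial derivatives; by the chain rule these are [g_x + beta g_y],
    [g_x - beta g_y] and [g_t]. *)
Lemma base_poly_gradient (P Q : 'rV[K]_3) :
  gradient p P = Q <->
  [/\ l * L2 P + d * L1 P - B * eta P = Q 0 0 + beta * Q 0 1,
      l ^+ q * L2 P + d ^+ q * L1 P - B * xi P = Q 0 0 - beta * Q 0 1
    & L1 P + L2 P = Q 0 2].
Proof.
have two0 := two_neq0; have beta0 := beta_neq0.
have gE i : gradient p P 0 i = (p^`M(i)).@[P 0] by rewrite mxE.
have g0 : l * L2 P + d * L1 P - B * eta P = gradient p P 0 0 + beta * gradient p P 0 1.
  rewrite !gE base_polyE !(mderivB, mderivM, mderivD, mderivC, mderivXU) /=.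
  rewrite !(mevalB, mevalM, mevalD, mevalC, mevalXU, meval0, meval1).
  by field; rewrite two0 beta0.
have g1 : l ^+ q * L2 P + d ^+ q * L1 P - B * xi P
    = gradient p P 0 0 - beta * gradient p P 0 1.
  rewrite !gE base_polyE !(mderivB, mderivM, mderivD, mderivC, mderivXU) /=.
  rewrite !(mevalB, mevalM, mevalD, mevalC, mevalXU, meval0, meval1).
  by field; rewrite two0 beta0.
have g2 : L1 P + L2 P = gradient p P 0 2.
  rewrite !gE base_polyE !(mderivB, mderivM, mderivD, mderivC, mderivXU) /=.
  rewrite !(mevalB, mevalM, mevalD, mevalC, mevalXU, meval0, meval1).
  by field; rewrite two0 beta0.
rewrite g0 g1 g2; split => [-> //|[h0 h1 h2]].
have e0 : gradient p P 0 0 = Q 0 0.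
  apply: (mulfI two0); rewrite !mulr_natl.
  transitivity ((gradient p P 0 0 + beta * gradient p P 0 1) +
     (gradient p P 0 0 - beta * gradient p P 0 1)); first by ring.
  by rewrite h0 h1; ring.
have e1 : gradient p P 0 1 = Q 0 1.
  by apply: (mulfI beta0); move: h0; rewrite e0 => /addrI.
apply/rowP => -[[|[|[|//]]] i].
- by rewrite (_ : Ordinal i = 0) //; apply: val_inj.
- by rewrite (_ : Ordinal i = 1) //; apply: val_inj.
by rewrite (_ : Ordinal i = 2) //; apply: val_inj.
Qed.

Lemma pencil_point (u v t : K) :
  exists P : 'rV[K]_3, [/\ xi P = u, eta P = v & P 0 2 = t].
Proof.
exists (hcoord (u + v) (beta * (u - v)) t); rewrite !mxE /=.
by split=> //; field; rewrite two_neq0 beta_neq0.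
Qed.

(** If [b] or [D] vanishes, an explicit singular point exists. For [b = 0] the conic degenerates to
    the lines [L1 = 0] and [L2 = 0]. *)
Lemma nonsingular_triangular : nonsingular p -> b != 0 /\ D != 0.
Proof.
move=> ns; have singular u v t :
    (u != 0) || (v != 0) -> let L1 := u * l + v * l ^+ q + t in
    let L2 := u * d + v * d ^+ q + t in
    L1 * L2 = u * v * B -> l * L2 + d * L1 = B * v ->
    l ^+ q * L2 + d ^+ q * L1 = B * u -> L1 + L2 = 0 -> False.
  move=> uv_neq0 M1 M2 e g0 g1 g2; have [P [Pu Pv Pt]] := pencil_point u v t.
  have onP : on_curve p P.
    split; last by rewrite base_poly_eval Pu Pv Pt -/M1 -/M2 e subrr.
    by apply: contraTneq uv_neq0 => P0; rewrite -Pu -Pv P0 !mxE !mul0r subr0 addr0 eqxx.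
  have /negP[] := ns P onP; apply/eqP/base_poly_gradient.
  by rewrite Pu Pv Pt -/M1 -/M2 g0 g1 g2 !mxE mulr0 addr0 subr0 !subrr.
have m'E : m ^+ q = d ^+ q - l ^+ q by rewrite (conjB iota hq hF).
have b_neq0 : b != 0.
  apply/eqP => b0; have B0 : B = 0 by rewrite b0 mul0r.
  (* If also [m = 0], the two lines coincide and each of their points is singular. *)
  have [m0|m_neq0] := eqVneq m 0.
    have dl : d = l by apply/eqP; rewrite -subr_eq0 m0.
    by apply: (@singular 1 0 (- l)); rewrite ?oner_neq0 //= ?B0 ?dl; ring.
  have mm : (m ^+ q != 0) || (- m != 0) by rewrite oppr_eq0 m_neq0 orbT.
  (* The intersection of the two distinct lines. *)
  apply: (@singular (m ^+ q) (- m) (m * l ^+ q - m ^+ q * l) mm);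
    by rewrite /= ?B0 m'E; ring.
split=> //; apply/eqP => D0; have BE : B = - (m * m ^+ q).
  by apply/eqP; rewrite -addr_eq0 addrC D0.
have mm : (- m ^+ q != 0) || (- m != 0).
  rewrite !oppr_eq0 orbC; apply/orP; left; apply: contraNneq b_neq0 => m0.
  by rewrite -(norm_eq0 q) BE m0 mul0r oppr0.
(* At this point [L1 = - B] and [L2 = B], which solves the gradient equations once [B = - |m|^2]. *)
apply: (@singular (- m ^+ q) (- m) (m ^+ q * l + m * l ^+ q - B) mm);
  by rewrite /= ?BE m'E; ring.
Qed.

Hypotheses (b_neq0 : b != 0) (D_neq0 : D != 0).

(* At the point of tangency P the scaled value L1 P / c is a double root of the
   quadratic equation whose roots in F parametrise the fibre. *)
Lemma in_boundary_curveP (z : K) :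
  let Z := z - l in let T := m ^+ q * Z + m * Z ^+ q + B in
  in_boundary_curve iota q beta A z <-> T ^+ 2 - 4 * D * (Z * Z ^+ q) = 0.
Proof.
move=> Z T; have m'E : m ^+ q = d ^+ q - l ^+ q by rewrite (conjB iota hq hF).
have Z'E : Z ^+ q = z ^+ q - l ^+ q by rewrite (conjB iota hq hF).
have two0 := two_neq0.
have b'_neq0 : b ^+ q != 0 by rewrite expf_eq0 negb_and b_neq0 orbT.
split=> [[x [y [zE [_ [P [c [[_ eP] c_neq0]]]]]]]|disc0].
  case/base_poly_gradient; rewrite !mxE /= mulr1.
  rewrite [beta * (c * _)]mulrCA -mulrDr -mulrBr -zE.
  rewrite -(conj_coord hF halpha hbeta) -zE => g0 g1 g2.
  rewrite base_poly_eval in eP.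
  move: eP g0 g1 g2; set u := xi P; set v := eta P; set t := P 0 2.
  pose M := u * l + v * l ^+ q + t; rewrite -/M; pose M' := u * d + v * d ^+ q + t.
  rewrite -/M' => eP g0 g1 g2.
  have M'E : M' = M + u * m + v * m ^+ q by rewrite /M' /M m'E; ring.
  have Bv : B * v = m * M - c * Z.
    have -> : B * v = l * M' + d * M - c * z by rewrite -g0; ring.
    by rewrite (_ : M' = c - M); [rewrite /Z; ring | rewrite -g2; ring].
  have Bu : B * u = m ^+ q * M - c * Z ^+ q.
    have -> : B * u = l ^+ q * M' + d ^+ q * M - c * z ^+ q by rewrite -g1; ring.
    by rewrite (_ : M' = c - M); [rewrite Z'E m'E; ring | rewrite -g2; ring].
  (* Eliminating [u], [v] and [M'] shows that [M / c] is half the sum [T / D] of the roots. *)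
  have lin : 2 * D * M = c * T.
    have : B * c = B * (M + M') by rewrite g2.
    have -> : B * (M + M') = 2 * B * M + m * (B * u) + m ^+ q * (B * v).
      by rewrite M'E; ring.
    rewrite Bu Bv => Bc.
    transitivity (c * (m ^+ q * Z + m * Z ^+ q) + B * c); last by rewrite /T; ring.
    by rewrite Bc; ring.
  (* The curve equation makes [(M / c) ^+ 2] the product [|Z|^2 / D] of the roots; with [lin] this
     kills the discriminant. *)
  have quad : D * M ^+ 2 = c ^+ 2 * (Z * Z ^+ q).
    have : B * (M * M') = (B * u) * (B * v).
      by rewrite (_ : M * M' = u * v * B); [ring | apply/eqP; rewrite -subr_eq0 eP].
    rewrite Bu Bv (_ : M' = c - M); last by rewrite -g2; ring.
    move=> e; have : c * T * M = 2 * D * M * M by rewrite lin.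
    move=> e2.
    have -> : c ^+ 2 * (Z * Z ^+ q) = 
      (m ^+ q * M - c * Z ^+ q) * (m * M - c * Z)
      + c * T * M - c * B * M - m * m ^+ q * M ^+ 2.
      by rewrite /T; ring.
    by rewrite -e e2; ring.
  apply: (mulfI (expf_neq0 2 c_neq0)); rewrite mulr0 mulrBr -exprMn -lin.
  rewrite mulrCA -quad; ring.
have [x [y zE]] : exists x y, z = iota x + beta * iota y.
  exact: (conj_decomposition hq hF hK halpha hbeta).
(* [M] is the double root; [u] and [v] solve the gradient equations for [c = 1] and [L2 = 1 - M],
   and [t] is chosen so that [L1 = M]. *)
pose M := T / (2 * D); pose u := (m ^+ q * M - Z ^+ q) / B.
pose v := (m * M - Z) / B; pose t := M - u * l - v * l ^+ q.
have MT : T = 2 * D * M by rewrite mulrC divfK // mulf_neq0.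
have [P [Pu Pv Pt]] := pencil_point u v t.
have ME : L1 P = M by rewrite Pu Pv Pt /t; ring.
have M'E : L2 P = 1 - M.
  transitivity (M + (u * m + v * m ^+ q)).
    by rewrite Pu Pv Pt /t m'E; ring.
  have -> : u * m + v * m ^+ q = (2 * D * M - T) / B + 1 - 2 * M.
    by rewrite /u /v /T; field; rewrite b_neq0 b'_neq0.
  by rewrite -MT subrr mul0r; ring.
exists x, y; split=> //; split.
  apply/eqP => /rowP/(_ 2); rewrite !mxE /= => /eqP; by rewrite oner_eq0.
exists P, 1; split; last first.
- rewrite scale1r; apply/base_poly_gradient; rewrite ME M'E Pu Pv !mxE /=.
  rewrite -zE -(conj_coord hF halpha hbeta) -zE; split; last by ring.
    by rewrite /v /Z; field; rewrite b_neq0 b'_neq0.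
  by rewrite /u Z'E m'E; field; rewrite b_neq0 b'_neq0.
- exact: oner_neq0.
split.
  apply/eqP => P0; have : L1 P + L2 P = 1 by rewrite ME M'E; ring.
  rewrite P0 !mxE !(mul0r, addr0, subr0) => /eqP; by rewrite eq_sym oner_eq0.
rewrite base_poly_eval ME M'E Pu Pv.
have D4_neq0 : 4 * D != 0 by rewrite mulf_neq0 // (_ : 4 = 2 * 2) ?mulf_neq0 //; ring.
have ZN : Z * Z ^+ q = D * M ^+ 2.
  apply: (mulfI D4_neq0); apply/eqP; rewrite eq_sym -subr_eq0 -[X in _ == X]disc0 MT.
  by apply/eqP; ring.
transitivity ((M * T - D * M ^+ 2 - Z * Z ^+ q) / B).
  by rewrite /u /v /T; field; rewrite b_neq0 b'_neq0.
by rewrite MT ZN (_ : _ - _ - _ = 0) ?mul0r //; ring.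
Qed.

End TriangularBaseCurve.

(** * Transfer from the triangular form back to [A] *)

Lemma in_boundary_curve_congr (F K : finFieldType) (iota : {rmorphism F -> K})
    (q n : nat) (beta : K) (A A' : 'M[K]_n) (z : K) :
  base_poly q beta A = base_poly q beta A' ->
  in_boundary_curve iota q beta A z <-> in_boundary_curve iota q beta A' z.
Proof.
rewrite /in_boundary_curve; move: (base_poly q beta A') => p'.
by move: (base_poly q beta A) => p ->; apply: iff_refl.
Qed.

Theorem theorem1p4 (q : nat) (hq : odd q)
    (F K : finFieldType) (hF : #|F| = q) (hK : #|K| = (q ^ 2)%N)
    (iota : {rmorphism F -> K})
    (alpha : F) (halpha : forall x : F, x ^+ 2 != alpha)
    (beta : K) (hbeta : beta ^+ 2 = iota alpha)
    (A : 'M[K]_2)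
    (hns : nonsingular (base_poly q beta A))
    (heig : exists lambda : K, exists u : 'cV[K]_2,
        is_eigenpair A lambda u /\ herm q u u != 0)
    (z : K) (hz : z \in numerical_range q A) :
  let S := nr_fiber q A z in
  let U := unitaries iota alpha beta in
  (in_boundary_curve iota q beta A z ->
     #|scaling_orbits S U| = 1%N /\ #|S| = (q + 1)%N) /\
  (~ in_boundary_curve iota q beta A z ->
     #|scaling_orbits S U| = 2%N /\ #|S| = (2 * q + 2)%N).
Proof.
move=> S U; have [lambda [u [Au uu]]] := heig.
have [V VV A10] := unitary_triangularization iota hq hF hK Au uu.
have baseE := base_poly_unitary iota hF hK A VV beta.
have SE : S = _ := nr_fiber_unitary iota hF A VV z.
move: (adjmx q V *m A *m V) A10 baseE SE => B A10 baseE SE.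
have boundaryE :
    in_boundary_curve iota q beta A z <-> in_boundary_curve iota q beta B z.
  exact: in_boundary_curve_congr (esym baseE).
have [b_neq0 D_neq0] : B 0 1 != 0 /\
    (B 1 1 - B 0 0) * (B 1 1 - B 0 0) ^+ q + B 0 1 * B 0 1 ^+ q != 0.
  by apply: (nonsingular_triangular hq hF halpha hbeta A10); rewrite baseE.
(* Membership of [z] in the numerical range enters here: a point of the fibre gives the quadratic a
   first root in [F]. *)
have fiber_neq0 : nr_fiber q B z != set0.
  have [v vN zE] := imsetP hz; have : v \in S.
    by move: vN; rewrite !inE zE eqxx.
  by rewrite SE => /imsetP[w wB _]; apply/set0Pn; exists w.
have orbitsE : #|scaling_orbits S U| = #|scaling_orbits (nr_fiber q B z) U|.
  by rewrite SE; apply: scaling_orbits_mulmx VV.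
have SN : #|S| = #|nr_fiber q B z|.
  by rewrite SE; apply: card_imset (mulmx_linv_inj VV).
rewrite orbitsE SN /U (unitariesE hq hF hK halpha hbeta) boundaryE.
have [-> ->] := card_triangular_fiber iota hq hF hK z A10 b_neq0.
rewrite (card_fiber_roots iota hq hF hK A10 D_neq0 fiber_neq0).
rewrite (in_boundary_curveP hq hF hK halpha hbeta A10 b_neq0 D_neq0).
case: eqP => {baseE} disc; split=> // _; first by rewrite mul1n addn1.
by rewrite mulnS addnC.
Qed.
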